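(* Let $n>m\ge2$ be integers, let $\mathcal{D}\subset\{0,\dots,n-1\}\times\{0,\dots,m-1\}$ be a non-empty digit set, and let $A$ be the attractor of the Bedford–McMullen IFS $\{F_d\}_{d\in\mathcal{D}}$, $F_d(\vec x)=T(\vec x+d)$ with $T=\begin{pmatrix}1/n&0\\0&1/m\end{pmatrix}$. Then the extreme points of $A$ are described by a system of finitely many equations (a finite DGIFS) and functions $F_d$ where $d\in\mathcal{D}\cap\partial\operatorname{conv}(\mathcal{D})$.
   Context: The attractor $A$ is the unique non-empty compact set with $A=\bigcup_{d\in\mathcal{D}}F_d(A)$. The set of extreme points of $A$ is $\operatorname{ext}(A)=A\cap\partial\operatorname{conv}(A)$ (all points of $A$ on the boundary of its convex hull, not only vertices). DGIFS: a directed graph iterated function system consists of a finite directed graph $(V,E)$ (loops and multiple edges allowed, every vertex of out-degree at least $1$), with $E_{uv}$ the edges from $u$ to $v$, and a contraction $f_e$ for each edge $e$. It has a unique list of non-empty compact sets $\{B_u\}_{u\in V}$ with $B_u=\bigcup_{v\in V}\bigcup_{e\in E_{uv}}f_e(B_v)$ for all $u\in V$ (one equation per vertex). The extreme points ''are described by'' the system with functions $F_d$, $d\in S$, if every $f_e$ is one of the maps $F_d$ with $d\in S$ and $\operatorname{ext}(A)=\bigcup_{u\in V}B_u$. *)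

(* Defs.v *)
From HB Require Import structures.
From mathcomp Require Import all_boot all_order all_algebra.
From mathcomp Require Import all_classical all_reals all_analysis.

Set Implicit Arguments.
Unset Strict Implicit.
Unset Printing Implicit Defensive.

Import Order.TTheory GRing.Theory Num.Theory.
Import numFieldNormedType.Exports.

Local Open Scope classical_set_scope.
Local Open Scope ring_scope.

Definition boundary (X : topologicalType) (Y : set X) : set X :=
  closure Y `\` interior Y.

Definition convex_hull (R : realType) (X : normedModType R) (Y : set X) :
    set X :=
  smallest (@convex_set R X) Y.

(* All points of [A] on the boundary of its hull, not only the points that are
   extreme in the sense of Krein-Milman. The boundary is relative to the whole
   space [X]; if conv(A) has empty interior, all of [A] is extreme. *)
Definition ext (R : realType) (X : normedModType R) (A : set X) : set X :=
  A `&` boundary (convex_hull A).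

Definition is_attractor (R : realType) (X : normedModType R) (I : Type)
    (S : set I) (F : I -> X -> X) (A : set X) : Prop :=
  [/\ A !=set0, compact A & A = \bigcup_(d in S) (F d @` A)].

(* Loops and parallel edges are allowed. *)
Record dgifs (R : realType) (X : normedModType R) := DGIFS {
  vertex : finType;
  edge : finType;
  source : edge -> vertex;
  target : edge -> vertex;
  edge_map : edge -> X -> X;
  edge_mapP : forall e, exists q : {nonneg R},
    q%:num < 1 /\ q%:num.-lipschitz (edge_map e);
  out_degree_gt0 : forall u, exists e, source e = u
}.

Definition edges (R : realType) (X : normedModType R) (G : dgifs X)
    (u v : vertex G) : set (edge G) :=
  [set e | source e = u /\ target e = v].

Definition is_dgifs_attractor (R : realType) (X : normedModType R)
    (G : dgifs X) (B : vertex G -> set X) : Prop :=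
  forall u, [/\ B u !=set0, compact (B u) &
    B u = \bigcup_v \bigcup_(e in edges u v) (edge_map e @` B v)].

(* In a complete space the list [B] is determined by [G], by the contraction
   principle. *)
Definition described_by (R : realType) (X : normedModType R) (I : Type)
    (S : set I) (F : I -> X -> X) (Y : set X) : Prop :=
  exists (G : dgifs X) (B : vertex G -> set X),
    [/\ forall e : edge G, exists2 d, S d & edge_map e = F d,
        is_dgifs_attractor B &
        Y = \bigcup_u B u].

(* The plane is [R * R]. Its library norm is the sup norm rather than the
   Euclidean one: the topology is the same, and the maps [bm_map d] below are
   contractions for both norms, with ratio 1/m when 2 <= m < n. *)
Definition digit_pt (R : realType) (n m : nat) (d : 'I_n * 'I_m) : R * R :=
  ((d.1 : nat)%:R, (d.2 : nat)%:R).

(* T (x + d) for T = diag(1/n, 1/m). *)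
Definition bm_map (R : realType) (n m : nat) (d : 'I_n * 'I_m) (x : R * R) :
    R * R :=
  let y := x + digit_pt R d in (n%:R^-1 * y.1, m%:R^-1 * y.2).

Definition boundary_digits (R : realType) (n m : nat)
    (D : {set 'I_n * 'I_m}) : set ('I_n * 'I_m) :=
  [set d | d \in D /\
    boundary (convex_hull (@digit_pt R n m @` [set` D])) (digit_pt R d)].

(* Main.v *)
(* For a direction c <> 0 let E(c) be the set of points of A maximizing the
   functional c. By a supporting line argument ext(A) is the union of the
   E(c), and E(c) is the union of the F_d(E(T c)), for d in the face of D
   maximizing T c. Call c = (a, b) flat if n|a| <= |b| and steep if m|b| <=
   |a|. Digits being integers, the face of a flat or steep direction depends
   only on the signs of a and b. Flatness is preserved by T, so E(c) depends
   only on the signs when c is flat, while T^-1 makes every other direction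
   steep in boundedly many steps. Hence the directions fall into finitely
   many states, recorded by the signs, flatness and the first faces along
   T^-k c, such that the union of the E(c) over a state is a union of images
   of the corresponding unions for the states of T c. These unions need not
   be closed (infinitely many edges of conv(A) may accumulate at a vertex),
   but their closures satisfy the same equations, and the union of the
   closures is ext(A), which is closed. *)
Require Import Defs.
From HB Require Import structures.
From mathcomp Require Import all_boot all_order all_algebra.
From mathcomp Require Import all_classical all_reals all_analysis.
From mathcomp Require Import zify ring lra.
Set Implicit Arguments.
Unset Strict Implicit.
Import Order.TTheory GRing.Theory Num.Theory.
Import numFieldNormedType.Exports.
Local Open Scope classical_set_scope.
Local Open Scope ring_scope.

(** * Supporting lines of convex sets in the plane *)

Section Planar.
Variable R : realType.
Implicit Types (c x y z p : R * R) (C Y : set (R * R)).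

Definition dot c x : R := c.1 * x.1 + c.2 * x.2.

Definition conv_closed C := forall y z (l : R), C y -> C z ->
  0 <= l -> l <= 1 -> C (l * y.1 + (1 - l) * z.1, l * y.2 + (1 - l) * z.2).

Lemma convex_setP C :
  convex_set (C : set (convex_lmodType (R * R)%type)) <-> conv_closed C.
Proof.
split=> [cC y z l Cy Cz l0 l1 | cC y z l /set_mem Cy /set_mem Cz].
  have := cC y z (Itv01 l0 l1) (mem_set Cy) (mem_set Cz).
  by move/set_mem.
exact/mem_set/(cC y z l%:num).
Qed.

Lemma conv_closed_hull Y : conv_closed (convex_hull Y).
Proof.
move=> y z l Yy Yz l0 l1 C CY; have [/convex_setP cC _] := CY.
exact: cC (Yy _ CY) (Yz _ CY) l0 l1.
Qed.

Lemma dot_hull_le Y c (r : R) : (forall y, Y y -> dot c y <= r) ->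
  forall y, convex_hull Y y -> dot c y <= r.
Proof.
move=> Yr; apply: (@smallest_sub _ _ Y [set y | dot c y <= r]) => //.
apply/convex_setP => y z l /=; rewrite /dot /= => yr zr l0 l1.
nra.
Qed.

Lemma segment_around C x p : conv_closed C -> C x ->
    (exists2 t, 0 < t & C (x + t *: p)) ->
    (exists2 t, 0 < t & C (x + t *: - p)) ->
  exists2 t, 0 < t & forall s, `|s| <= t -> C (x + s *: p).
Proof.
move=> cC Cx [t1 t10 Ct1] [t2 t20 Ct2].
exists (Num.min t1 t2) => [|s]; first by rewrite lt_min t10 t20.
rewrite le_min => /andP[/ler_normlP[_ s1] /ler_normlP[s2 _]].
have [s0|s0] := leP 0 s.
  have := cC _ _ (s / t1) Ct1 Cx.
  rewrite divr_ge0 ?ler_pdivrMr ?mul1r ?(ltW t10)// => /(_ isT s1).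
  congr C; case: x {Cx Ct1 Ct2} p => [x1 x2] [p1 p2].
  by congr pair => /=; rewrite /GRing.scale /=; field; rewrite gt_eqF.
have := cC _ _ (- s / t2) Ct2 Cx.
rewrite divr_ge0 ?ler_pdivrMr ?mul1r ?(ltW t20) ?oppr_ge0 ?(ltW s0)//.
move=> /(_ isT s2).
congr C; case: x {Cx Ct1 Ct2} p => [x1 x2] [p1 p2].
by congr pair => /=; rewrite /GRing.scale /=; field; rewrite gt_eqF.
Qed.

(** The segments through x along the two axes span a diamond inside C, which contains a sup-norm
    ball around x. *)
Lemma interior_cross C x : conv_closed C -> C x ->
    (forall p, p \in [:: (1, 0); (- 1, 0); (0, 1); (0, -1)] ->
       exists2 t, 0 < t & C (x + t *: p)) ->
  interior C x.
Proof.
move=> cC Cx Cp.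
have [||t1 t10 Ct1] := @segment_around C x (1, 0) cC Cx; first 2 last.
- have [||t2 t20 Ct2] := @segment_around C x (0, 1) cC Cx; first 2 last.
  + have e0 : 0 < Num.min t1 t2 / 2 by rewrite divr_gt0// lt_min t10 t20.
    apply/nbhs_ballP; exists (Num.min t1 t2 / 2) => //= y.
    rewrite -ball_normE /= prod_normE gt_max => /andP[/= y1 y2].
    have h1 : `|2 * (y.1 - x.1)| <= t1.
      rewrite normrM ger0_norm// mulrC -ler_pdivlMr// distrC.
      by rewrite (le_trans (ltW y1))// ler_pM2r// ge_min lexx.
    have h2 : `|2 * (y.2 - x.2)| <= t2.
      rewrite normrM ger0_norm// mulrC -ler_pdivlMr// distrC.
      by rewrite (le_trans (ltW y2))// ler_pM2r// ge_min lexx orbT.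
    (* y is the midpoint of a point of the horizontal segment and a point of the vertical one. *)
    have := cC _ _ (2^-1) (Ct1 _ h1) (Ct2 _ h2).
    rewrite invr_ge0 ler0n => /(_ isT) H.
    have /H : (2^-1 : R) <= 1 by lra.
    congr C; case: (x) (y) => [a b] [a' b'] /=.
    by rewrite /GRing.scale /=; congr pair; field.
  + by apply: Cp; rewrite !inE eqxx ?orbT.
  + have -> : - (0, 1) = (0, -1) :> R * R.
      by rewrite [LHS]surjective_pairing /= oppr0.
    by apply: Cp; rewrite !inE eqxx ?orbT.
- by apply: Cp; rewrite !inE eqxx ?orbT.
- have -> : - (1, 0) = (-1, 0) :> R * R.
    by rewrite [LHS]surjective_pairing /= oppr0.
  by apply: Cp; rewrite !inE eqxx ?orbT.
Qed.

(* In the frame (p, q) at x, convexity separates the slopes of the points of C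
   on the two sides of the line x + R p; the supremum of those on one side is
   the slope of a supporting line. *)
Lemma support_of_ray C x p : conv_closed C -> p.1 ^+ 2 + p.2 ^+ 2 = 1 ->
    (forall t, 0 < t -> ~ C (x + t *: p)) ->
  exists2 c, c != 0 & forall y, C y -> dot c y <= dot c x.
Proof.
move=> cC; case: x p => [x1 x2] [p1 p2] /= pp Cp.
have qN0 : (- p2, p1) != (0, 0) :> R * R.
  by apply/eqP => -[/eqP]; rewrite oppr_eq0 => /eqP q1 q2; move: pp; nra.
have qN0' : (p2, - p1) != (0, 0) :> R * R.
  by apply/eqP => -[q1 /eqP]; rewrite oppr_eq0 => /eqP q2; move: pp; nra.
(* [a] and [b] are the coordinates of y - x along p and along q = (- p2, p1). *)
pose a y := p1 * (y.1 - x1) + p2 * (y.2 - x2).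
pose b y := p1 * (y.2 - x2) - p2 * (y.1 - x1).
have y1E y : y.1 = x1 + a y * p1 - b y * p2.
  have -> : y.1 = x1 + (y.1 - x1) * 1 by ring.
  by rewrite -pp /a /b; ring.
have y2E y : y.2 = x2 + a y * p2 + b y * p1.
  have -> : y.2 = x2 + (y.2 - x2) * 1 by ring.
  by rewrite -pp /a /b; ring.
have [bp|/forallNP bn] := pselect (exists y, C y /\ 0 < b y); last first.
  exists (- p2, p1) => // y Cy; have /not_andP[//|/negP] := bn y.
  by rewrite -leNgt /b /dot /=; lra.
have [bm|/forallNP bn] := pselect (exists y, C y /\ b y < 0); last first.
  exists (p2, - p1) => // y Cy; have /not_andP[//|/negP] := bn y.
  by rewrite -leNgt /b /dot /=; lra.
(* With the slopes in the wrong order, the segment from z to y would cross the line x + R p at a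
   positive parameter, on the ray that C avoids. *)
have slopes y z : C y -> 0 < b y -> C z -> b z < 0 -> a y / b y <= a z / b z.
  move=> Cy by0 Cz bz0; rewrite leNgt; apply/negP => lt_slope.
  have bb : 0 < b y - b z by lra.
  have := cC _ _ (- b z / (b y - b z)) Cy Cz.
  have l0 : 0 <= - b z / (b y - b z) by rewrite divr_ge0; lra.
  have l1 : - b z / (b y - b z) <= 1 by rewrite ler_pdivrMr; lra.
  move=> /(_ l0 l1).
  have := Cp ((a y * - b z + a z * b y) / (b y - b z)).
  have gt0 : 0 < a y * - b z + a z * b y.
    move: lt_slope; rewrite -subr_gt0.
    rewrite -(pmulr_rgt0 _ (_ : 0 < b y * - b z)); last first.
      by rewrite mulr_gt0; lra.
    by congr (0 < _); field; rewrite (lt_eqF bz0) (gt_eqF by0).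
  rewrite divr_gt0// => /(_ isT) h H; apply: h; move: H; congr C.
  rewrite (y1E y) (y1E z) (y2E y) (y2E z).
  by congr pair => /=; rewrite /GRing.scale /=; field; rewrite gt_eqF.
pose S := [set a y / b y | y in [set y | C y /\ 0 < b y]].
have [y0 [Cy0 by0]] := bp; have [z0 [Cz0 bz0]] := bm.
have supS : has_sup S.
  split; first by exists (a y0 / b y0), y0.
  by exists (a z0 / b z0) => _ [y [Cy b0] <-]; exact: slopes.
pose s := sup S.
(* This is p - s q, whose value on y - x is a y - s * b y. *)
exists (p1 + s * p2, p2 - s * p1) => [|y Cy].
  by apply/eqP => -[c1 c2]; move: pp; nra.
suff : a y <= s * b y by rewrite /dot /a /b /=; lra.
have [b0|b0|b0] := ltgtP (b y) 0.
- rewrite -ler_ndivlMr//; apply: ge_sup; first by case: supS.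
  by move=> _ [z [Cz bz] <-]; exact: slopes.
- rewrite -ler_pdivrMr//; apply: ub_le_sup; first by case: supS.
  by exists y.
- rewrite b0 mulr0 leNgt; apply/negP => /Cp; apply; move: Cy; congr C.
  rewrite [LHS]surjective_pairing (y1E y) (y2E y) b0.
  by congr pair => /=; rewrite /GRing.scale /=; ring.
Qed.

(** If x is not interior, [interior_cross] gives an axis ray from x that avoids the hull, and
    [support_of_ray] applies. Conversely, a small step from x along c leaves the half-plane that
    contains the hull. *)
Lemma boundary_hullP Y x : Y x ->
  boundary (convex_hull Y) x <->
  exists2 c, c != 0 & forall y, Y y -> dot c y <= dot c x.
Proof.
move=> Yx; have hYx : convex_hull Y x by apply: sub_gen_smallest.
split=> [[_ nint]|[c c0 cmax]]; last first.
  split; first exact: subset_closure.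
  move=> /nbhs_ballP[e /= e0 eY].
  have cc0 : 0 < c.1 ^+ 2 + c.2 ^+ 2.
    case: c c0 {cmax} => c1 c2 c0 /=.
    rewrite lt_neqAle addr_ge0 ?sqr_ge0// andbT.
    rewrite eq_sym paddr_eq0 ?sqr_ge0// !sqrf_eq0.
    by apply: contra c0 => /andP[/eqP -> /eqP ->].
  have cn0 : 0 < `|c| by rewrite normr_gt0.
  pose t := e / 2 / `|c|.
  have t0 : 0 < t by rewrite !divr_gt0.
  have /eY : ball x e (x + t *: c).
    rewrite -ball_normE /= opprD addrA subrr sub0r normrN normrZ.
    by rewrite gtr0_norm// /t divfK ?gt_eqF//; lra.
  move/(@dot_hull_le Y c (dot c x) cmax); rewrite /dot /= /GRing.scale /=.
  by nra.
have cC := @conv_closed_hull Y.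
have [H|/existsNP[p /not_implyP[pin Hp]]] := pselect (forall p,
    p \in [:: (1, 0); (- 1, 0); (0, 1); (0, -1)] ->
    exists2 t, 0 < t & convex_hull Y (x + t *: p)).
  by case: nint; exact: interior_cross.
have [||c c0 cmax] := @support_of_ray (convex_hull Y) x p cC.
- by move: pin; rewrite !inE => /or4P[] /eqP -> /=; ring.
- by move=> t t0 Ct; apply: Hp; exists t.
- by exists c => // y Yy; apply: cmax; exact: sub_gen_smallest.
Qed.
End Planar.

(** * Signs of forms with a dominant coefficient, and a power inequality *)

Lemma lt_term_of_dominated (R : realType) (a b u v N : R) : b != 0 ->
  `|a| * N <= `|b| -> `|u| <= N - 1 -> 1 <= `|v| -> `|a * u| < `|b * v|.
Proof.
rewrite -normr_gt0 !normrM => b0 ab uN v1.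
have [->|] := eqVneq a 0; first by rewrite normr0 mul0r; nra.
by rewrite -normr_gt0 => a0; have := normr_ge0 u; nra.
Qed.

(** The term in v decides the sign unless v = 0, and then the term in u does: the comparison is
    lexicographic, so only the signs of the coefficients enter. *)
Lemma lex_sign_le (R : realType) (a b a' b' u v N : R) :
    b != 0 -> b' != 0 -> `|a| * N <= `|b| -> `|a'| * N <= `|b'| ->
    ((0 < a) = (0 < a')) * ((a < 0) = (a' < 0)) ->
    ((0 < b) = (0 < b')) * ((b < 0) = (b' < 0)) ->
    `|u| <= N - 1 -> v = 0 \/ 1 <= `|v| ->
  (a * u + b * v <= 0) = (a' * u + b' * v <= 0).
Proof.
have half a1 b1 a2 b2 : b1 != 0 -> b2 != 0 ->
    `|a1| * N <= `|b1| -> `|a2| * N <= `|b2| ->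
    ((0 < a1) = (0 < a2)) * ((a1 < 0) = (a2 < 0)) ->
    ((0 < b1) = (0 < b2)) * ((b1 < 0) = (b2 < 0)) ->
    `|u| <= N - 1 -> v = 0 \/ 1 <= `|v| ->
    a1 * u + b1 * v <= 0 -> a2 * u + b2 * v <= 0.
  move=> b10 b20 ab1 ab2 [sa1 sa2] [sb1 sb2] uN [->|v1].
    rewrite !mulr0 !addr0; have [a2n|a2p|a2z] := ltgtP a2 0.
    - by move: sa2; rewrite a2n => a1n; nra.
    - by move: sa1; rewrite a2p => a1p; nra.
    - by rewrite a2z mul0r.
  have := lt_term_of_dominated b10 ab1 uN v1.
  have := lt_term_of_dominated b20 ab2 uN v1.
  rewrite ltr_norml => /andP[h1 h2]; rewrite ltr_norml => /andP[h3 h4] le1.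
  have bv1 : b1 * v < 0.
    rewrite ltNge; apply/negP => bv; move: h3; rewrite ger0_norm//; lra.
  suff bv2 : b2 * v < 0 by move: h2; rewrite ltr0_norm//; lra.
  move: b10 bv1; rewrite neq_lt => /orP[b1n|b1p] bv1.
    by move: sb2; rewrite b1n => /esym b2n; nra.
  by move: sb1; rewrite b1p => /esym b2p; nra.
move=> b0 b0' ab ab' sa sb uN v1; case: (sa) (sb) => [sa1 sa2] [sb1 sb2].
by apply/idP/idP; [apply: (half a b a' b')|apply: (half a' b' a b)].
Qed.

(** By Bernoulli, n^K >= (m+1)^K >= K m^(K-1), and K >= m^3. *)
Lemma expn_gap (m n K : nat) : (m < n)%N -> (m ^ 3 <= K)%N ->
  (m ^ K.+2 <= n ^ K)%N.
Proof.
move=> mn mK.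
have bern k : (m ^ k.+1 + k.+1 * m ^ k <= m.+1 ^ k.+1)%N.
  elim: k => [|k IH]; first by rewrite !expn1 expn0 addn1.
  rewrite (expnS m.+1) (expnS m k.+1).
  move: IH; rewrite (expnS m k); nia.
case: m mn mK bern => [|m] mn mK bern; first by rewrite exp0n.
case: K mK => [|K] mK; first by move: mK; rewrite leqn0 expn_eq0.
apply: (@leq_trans (m.+2 ^ K.+1)); last by rewrite leq_exp2r.
apply: leq_trans (bern K); apply: leq_trans (leq_addl _ _).
by rewrite -[K.+3]/(3 + K)%N expnD leq_mul2r mK orbT.
Qed.

(** * Exposed sets of the attractor and their recursion *)

Section Exposed.
Variables (R : realType) (n m : nat).
Hypotheses (hm : (2 <= m)%N) (hnm : (m < n)%N).
Variables (D : {set 'I_n * 'I_m}) (A : set (R * R)%type).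
Hypothesis hA : is_attractor [set` D] (@bm_map R n m) A.
Implicit Types (c x y : (R * R)%type) (d e : 'I_n * 'I_m).

(** T is diagonal, hence its own transpose: [shrink] is T acting on directions, and [expand] is its
    inverse. *)
Definition shrink c : (R * R)%type := (n%:R^-1 * c.1, m%:R^-1 * c.2).
Definition expand c : (R * R)%type := (n%:R * c.1, m%:R * c.2).

Let n2 : (2 <= n)%N. Proof. exact: leq_trans (ltnW hnm). Qed.
Let n0 : 0 < n%:R :> R. Proof. by rewrite ltr0n ltnW. Qed.
Let m0 : 0 < m%:R :> R. Proof. by rewrite ltr0n ltnW. Qed.
Let mn : m%:R <= n%:R :> R. Proof. by rewrite ler_nat ltnW. Qed.

Lemma shrinkK : cancel shrink expand.
Proof.
by case=> a b; rewrite /shrink /expand /= !mulrA !mulfV ?mul1r// gt_eqF.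
Qed.

Lemma expandK : cancel expand shrink.
Proof.
by case=> a b; rewrite /shrink /expand /= !mulrA !mulVf ?mul1r// gt_eqF.
Qed.

Lemma dot_bm_map c d x :
  dot c (bm_map d x) = dot (shrink c) x + dot (shrink c) (digit_pt R d).
Proof. by rewrite /dot /bm_map /=; ring. Qed.

Definition face c : {set 'I_n * 'I_m} :=
  finset (fun d => (d \in D) &&
    [forall e in D, dot c (digit_pt R e) <= dot c (digit_pt R d)]).

Lemma faceP c d : reflect
  (d \in D /\
   forall e, e \in D -> dot c (digit_pt R e) <= dot c (digit_pt R d))
  (d \in face c).
Proof.
by rewrite inE; apply: (iffP andP) => -[dD h]; split=> //; exact/forall_inP.
Qed.

Definition exposed c : set (R * R)%type :=
  [set x | A x /\ forall y, A y -> dot c y <= dot c x].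

Lemma attractor_bm_map d y : d \in D -> A y -> A (bm_map d y).
Proof. by case: hA => _ _ AE dD Ay; rewrite AE; exists d => //; exists y. Qed.

(** On F_d(y) the functional c is a term in y plus a term in d, and the two are maximized
    independently. With [exposed_inv] this is the recursion for E(c). *)
Lemma exposed_bm_map c d y : d \in face (shrink c) -> exposed (shrink c) y ->
  exposed c (bm_map d y).
Proof.
move=> /faceP[dD dmax] [Ay ymax]; split; first exact: attractor_bm_map.
case: hA => _ _ AE z; rewrite {1}AE => -[e /= eD [w Aw <-]].
by rewrite !dot_bm_map lerD// ?ymax ?dmax.
Qed.

Lemma exposed_inv c x : exposed c x ->
  exists d y, [/\ d \in face (shrink c), exposed (shrink c) y & x = bm_map d y].
Proof.
case: hA => _ _ AE [Ax]; move: (Ax); rewrite {1}AE => -[d /= dD [y Ay <-]] xmax.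
exists d, y; split=> //.
  apply/faceP; split=> // e eD; have := xmax _ (attractor_bm_map eD Ay).
  by rewrite !dot_bm_map lerD2l.
split=> // z Az; have := xmax _ (attractor_bm_map dD Az).
by rewrite !dot_bm_map lerD2r.
Qed.

Lemma exposed_nonempty c : exposed c !=set0.
Proof.
case: hA => A0 cA _.
have cdot : continuous (dot c).
  move=> x; apply: cvgD; apply: cvgMr; [exact: cvg_fst|exact: cvg_snd].
have [x /set_mem Ax xmax] :=
  compact_EVT_max A0 cA (continuous_subspaceT cdot).
by exists x; split=> // y /mem_set; exact: xmax.
Qed.

(** * Flat and steep directions and their faces *)

Definition signs c := (0 < c.1, c.1 < 0, (0 < c.2, c.2 < 0)).

Lemma signs_shrink c : signs (shrink c) = signs c.
Proof.
by rewrite /signs /= !pmulr_rgt0 ?invr_gt0// !pmulr_rlt0 ?invr_gt0.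
Qed.

Lemma signs_iter k c : signs (iter k expand c) = signs c.
Proof.
by elim: k => //= k <-; rewrite -signs_shrink expandK.
Qed.

Lemma signs_eq0 c c' : signs c = signs c' -> (c == 0) = (c' == 0).
Proof.
have E y : (y == 0) = (signs y == (false, false, (false, false))).
  case: y => a b; rewrite /signs /= !xpair_eqE !eqbF_neg -!leNgt.
  by rewrite -!eq_le.
by move=> h; rewrite !E h.
Qed.

Lemma shrink_eq0 c : (shrink c == 0) = (c == 0).
Proof. exact/signs_eq0/signs_shrink. Qed.

Definition flat c := `|c.1| * n%:R <= `|c.2|.
Definition steep c := `|c.2| * m%:R <= `|c.1|.

Lemma digit_diff N (i j : 'I_N) :
  `|(i : nat)%:R - (j : nat)%:R : R| <= N%:R - 1.
Proof.
have := ltn_ord i; have := ltn_ord j; rewrite -!(ler_nat R) -![(_.+1)%:R]natr1.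
by move=> ? ?; have := ler0n R i; have := ler0n R j; rewrite ler_norml; lra.
Qed.

Lemma nat_diff (i j : nat) :
  (i%:R - j%:R : R) = 0 \/ 1 <= `|i%:R - j%:R : R|.
Proof.
have [lt_ij|lt_ji|->] := ltngtP i j; [right|right|by left; rewrite subrr].
  move: lt_ij; rewrite -(ler_nat R) -natr1 => h.
  by rewrite distrC ger0_norm; lra.
move: lt_ji; rewrite -(ler_nat R) -natr1 => h.
by rewrite ger0_norm; lra.
Qed.

Lemma eq_face c c' :
    (forall d e, (dot c (digit_pt R e) <= dot c (digit_pt R d)) =
                 (dot c' (digit_pt R e) <= dot c' (digit_pt R d))) ->
  face c = face c'.
Proof.
move=> H; apply/setP => d; rewrite !inE; congr (_ && _).
by apply: eq_forallb => e; rewrite H.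
Qed.

Lemma le_dot_digit c d e :
  (dot c (digit_pt R e) <= dot c (digit_pt R d)) =
  (c.1 * ((e.1 : nat)%:R - (d.1 : nat)%:R) +
   c.2 * ((e.2 : nat)%:R - (d.2 : nat)%:R) <= 0).
Proof.
rewrite /dot /= -subr_le0; congr (_ <= _).
by rewrite !mulrBr opprD addrACA.
Qed.

(** Digit differences are integers, at most n - 1 in the first coordinate, so a flat direction
    compares second coordinates and uses the first only to break ties. *)
Lemma face_flat c c' : c != 0 -> signs c = signs c' -> flat c -> flat c' ->
  face c = face c'.
Proof.
move=> c0 sg fc fc'.
have nz y : flat y -> y != 0 -> y.2 != 0.
  move=> fy; apply: contra => /eqP y2; move: fy; rewrite /flat y2 normr0.
  rewrite pmulr_lle0// normr_le0 => /eqP y1.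
  by rewrite [y]surjective_pairing y1 y2.
have c'0 : c' != 0 by rewrite -(signs_eq0 sg).
case: (sg) => s1 s2 s3 s4; apply: eq_face => d e; rewrite !le_dot_digit.
apply: (@lex_sign_le _ _ _ _ _ _ _ n%:R) => //; try exact: nz.
- exact: digit_diff.
- exact: nat_diff.
Qed.

Lemma face_steep c c' : c != 0 -> signs c = signs c' -> steep c -> steep c' ->
  face c = face c'.
Proof.
move=> c0 sg fc fc'.
have nz y : steep y -> y != 0 -> y.1 != 0.
  move=> fy; apply: contra => /eqP y1; move: fy; rewrite /steep y1 normr0.
  rewrite pmulr_lle0// normr_le0 => /eqP y2.
  by rewrite [y]surjective_pairing y1 y2.
have c'0 : c' != 0 by rewrite -(signs_eq0 sg).
case: (sg) => s1 s2 s3 s4; apply: eq_face => d e; rewrite !le_dot_digit.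
rewrite addrC [in RHS]addrC.
apply: (@lex_sign_le _ _ _ _ _ _ _ m%:R) => //; try exact: nz.
- exact: digit_diff.
- exact: nat_diff.
Qed.

(** T divides the first coordinate by n but the second only by m < n. *)
Lemma flat_shrink c : flat c -> flat (shrink c).
Proof.
rewrite /flat /= !normrM ![`|_^-1|]ger0_norm ?invr_ge0 ?(ltW n0) ?(ltW m0)//.
by move=> h; rewrite -mulrA ler_pM ?invr_ge0 ?mulr_ge0 ?(ltW n0)// lef_pV2.
Qed.

(* Along flat directions the faces met under iteration of shrink depend on the
   signs only, and the defect c' . (z - x) contracts by 1/m at every step. *)
Lemma exposed_flat c c' : c != 0 -> signs c = signs c' -> flat c -> flat c' ->
  exposed c `<=` exposed c'.
Proof.
case: hA => _ cA AE.
have [L [L0 AL]] : exists L : R, 0 < L /\ forall y, A y -> `|y| <= L.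
  have [M [_ AM]] := compact_bounded cA.
  exists (`|M| + 1); split; first by rewrite ltr_wpDl.
  by apply: AM; rewrite (le_lt_trans (ler_norm M))// ltrDl.
(* The bound [L] on A gives the case k = 0. The contraction factor 1/m is relaxed to 1/2, and
   letting k grow makes the defect nonpositive. *)
have defect k : forall c c' x z, c != 0 -> signs c = signs c' -> flat c ->
    flat c' -> exposed c x -> A z ->
    dot c' z - dot c' x <=
      (`|c'.1| + `|c'.2|) * (2 * L) * (2^-1) ^+ k.
  elim: k => [|k IH] {}c {}c' x z c0 sg fc fc'.
    move=> [Ax _] Az; rewrite expr0 mulr1 /dot.
    have := AL _ Ax; have := AL _ Az; rewrite !prod_normE !ge_max.
    move=> /andP[z1 z2] /andP[x1 x2].
    have h (a b b' : R) : `|b| <= L -> `|b'| <= L ->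
        a * (b - b') <= `|a| * (2 * L).
      move=> hb hb'; apply: (le_trans (ler_norm _)); rewrite normrM.
      by apply: ler_wpM2l => //; apply: (le_trans (ler_normB _ _)); lra.
    by have := h c'.1 _ _ z1 x1; have := h c'.2 _ _ z2 x2; lra.
  move=> /exposed_inv[d [y [dface yexp ->]]].
  rewrite {1}AE => -[e /= eD [w Aw <-]].
  have sg' : signs (shrink c) = signs (shrink c') by rewrite !signs_shrink.
  have c0' : shrink c != 0 by rewrite shrink_eq0.
  have := IH _ _ _ _ c0' sg' (flat_shrink fc) (flat_shrink fc') yexp Aw.
  rewrite !dot_bm_map.
  (* d is also maximal for [shrink c'], so the digit terms contribute at most 0 to the defect. *)
  rewrite (face_flat c0' sg') ?flat_shrink// in dface.
  have /faceP[_ /(_ e eD) le_de] := dface => le_wy.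
  have : (`|(shrink c').1| + `|(shrink c').2|) * (2 * L) * 2^-1 ^+ k <=
     (`|c'.1| + `|c'.2|) * (2 * L) * 2^-1 ^+ k.+1.
    rewrite exprS [_ * _ * (2^-1 * _)]mulrA ler_pM2r ?exprn_gt0 ?invr_gt0//.
    rewrite mulrAC ler_pM2r ?mulr_gt0// mulrDl /=.
    rewrite !normrM ![`|_^-1|]ger0_norm ?invr_ge0 ?(ltW n0) ?(ltW m0)//.
    by apply: lerD; rewrite mulrC ler_wpM2l// lef_pV2 ?posrE// ler_nat.
  lra.
move=> c0 sg fc fc' x xexp; have [Ax _] := xexp; split=> // z Az.
rewrite -subr_le0.
set a := _ - _.
set b := (`|c'.1| + `|c'.2|) * (2 * L).
have cvg0 : b * (2^-1) ^+ k @[k --> \oo] --> (b * 0 : R).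
  apply: cvgMr; apply: cvg_expr.
  by rewrite ger0_norm ?invr_ge0// invf_lt1// ltr1n.
rewrite -(mulr0 b); apply: (cvgr_to_ge cvg0).
by near=> k; apply: defect xexp Az.
Unshelve. all: by end_near. Qed.

(** * Finitely many states of directions *)

Lemma iter_expand k c : iter k expand c = (n%:R ^+ k * c.1, m%:R ^+ k * c.2).
Proof.
elim: k => [|k IH]; first by rewrite !expr0 !mul1r -surjective_pairing.
by rewrite iterS IH /expand /= !exprS !mulrA.
Qed.

Definition depth := (m ^ 3)%N.

(** Non-flatness gives |c.2| < n |c.1|; the inequality m^(K+2) <= n^K with K = [depth] absorbs the
    extra factor m required by [steep]. *)
Lemma steep_iter c : ~~ flat c -> steep (iter depth.+1 expand c).
Proof.
rewrite /flat -ltNge => fc.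
rewrite iter_expand /steep /= !normrM !normrX !normr_nat.
have : (m ^ depth.+2)%:R <= (n ^ depth)%:R :> R.
  by rewrite ler_nat expn_gap.
rewrite !natrX => gap.
apply: (@le_trans _ _ (m%:R ^+ depth.+2 * (`|c.1| * n%:R))).
  rewrite mulrAC -exprSr ler_wpM2l ?exprn_ge0 ?(ltW m0)//; exact: ltW.
rewrite [n%:R ^+ _]exprSr -[leRHS]mulrA [n%:R * _]mulrC ler_wpM2r//.
Qed.

(** The window of faces is long enough that shifting it by one step brings in only the face at step
    [depth.+1], where a non-flat direction has become steep and the signs decide. *)
Definition state c := (signs c, flat c,
  [ffun k : 'I_depth.+1 => face (iter k expand c)]).

Lemma eq_state c c' : signs c = signs c' -> flat c = flat c' ->
    (forall k, (k <= depth)%N ->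
       face (iter k expand c) = face (iter k expand c')) ->
  state c = state c'.
Proof.
move=> sg fl w; rewrite /state sg fl; congr pair.
by apply/ffunP => k; rewrite !ffunE w// -ltnS.
Qed.

Lemma state_face c c' : state c = state c' ->
  forall k, (k <= depth)%N -> face (iter k expand c) = face (iter k expand c').
Proof.
move=> /(congr1 snd)/ffunP w k kd.
by have := w (Ordinal (kd : (k < depth.+1)%N)); rewrite !ffunE.
Qed.

(* Backward determinism: outside the flat directions the state of c' determines
   that of expand c'; on flat directions the exposed set does not vary. *)
Lemma state_pullback c c' y : c != 0 -> state (shrink c) = state c' ->
    exposed c' y ->
  exists c'', [/\ c'' != 0, state c'' = state c, exposed (shrink c'') y &
    face (shrink c'') = face c'].
Proof.
move=> c0 sE yexp; have fE := state_face sE.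
have sg : signs (shrink c) = signs c' := congr1 (fun s => s.1.1) sE.
have fl : flat (shrink c) = flat c' := congr1 (fun s => s.1.2) sE.
have c'0 : c' != 0 by rewrite -(signs_eq0 sg) shrink_eq0.
have [fc|fc] := boolP (flat (shrink c)).
  (* Here [shrink c] and [c'] are both flat with the same signs, so E(c') lies in E(T c) and c
     itself serves. *)
  exists c; split=> //; last exact: (fE 0%N).
  by apply: exposed_flat yexp; rewrite // -fl.
have nflat z : ~~ flat (shrink z) -> ~~ flat z by apply/contra/flat_shrink.
have e0 : expand c' != 0 by rewrite -shrink_eq0 expandK.
have sg' : signs (expand c') = signs c.
  by rewrite -signs_shrink expandK -sg signs_shrink.
exists (expand c'); split=> //; last 2 first.
- by rewrite expandK.
- by rewrite expandK.
have fe : ~~ flat (expand c') by apply: nflat; rewrite expandK -fl.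
apply: eq_state => //; first by rewrite (negbTE fe) (negbTE (nflat _ fc)).
(* For k = [depth] the face is the one entering the window; the others are already recorded in the
   states of [shrink c] and [c']. *)
move=> k; rewrite leq_eqVlt => /orP[/eqP ->|kd].
  rewrite -{1}(shrinkK c) -!iterSr; apply: face_steep.
  - by rewrite (@signs_eq0 _ c') ?signs_iter.
  - by rewrite !signs_iter sg.
  - by apply: steep_iter; rewrite -fl.
  - exact: steep_iter.
by rewrite -{1}(shrinkK c) -!iterSr fE.
Qed.

(** * Regularity of the maps, boundary digits and closedness of ext(A) *)

Lemma lipschitz_bm_map d :
  (m%:R^-1).-lipschitz (@bm_map R n m d : (R * R)%type -> (R * R)%type).
Proof.
move=> [x y] _ /=; rewrite !prod_normE /= ge_max.
have sub (r a b t : R) : r * (a + t) - r * (b + t) = r * (a - b) by ring.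
rewrite !sub !normrM ![`|_^-1|]ger0_norm ?invr_ge0 ?(ltW n0) ?(ltW m0)//.
apply/andP; split.
  by apply: ler_pM; rewrite ?invr_ge0 ?(ltW n0)// ?lef_pV2// le_max lexx.
by rewrite ler_wpM2l ?invr_ge0 ?(ltW m0)// le_max lexx orbT.
Qed.

Lemma continuous_bm_map d : continuous (@bm_map R n m d).
Proof.
have aff (u v : R) (g : (R * R)%type -> R) x :
    g @ x --> g x -> u * (g z + v) @[z --> x] --> u * (g x + v).
  by move=> cg; apply: cvgMr; apply: cvgD => //; exact: cvg_cst.
by move=> x; apply: (cvg_pair (aff _ _ _ _ cvg_fst) (aff _ _ _ _ cvg_snd)).
Qed.

Lemma boundary_face c d : c != 0 -> d \in face c -> boundary_digits R D d.
Proof.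
move=> c0 /faceP[dD dmax]; split=> //.
have Yd : (@digit_pt R n m @` [set` D]) (digit_pt R d) by exists d.
apply/(boundary_hullP Yd); exists c => // _ [e eD <-]; exact: dmax.
Qed.

Lemma extE : ext A = \bigcup_(c in [set c | c != 0]) exposed c.
Proof.
apply/seteqP; split=> x.
  by move=> [Ax /(boundary_hullP Ax)[c c0 cmax]]; exists c.
move=> [c c0 [Ax xmax]].
by split=> //; apply/(boundary_hullP Ax); exists c.
Qed.

Lemma closed_ext : closed (ext A).
Proof.
case: hA => _ cA _; apply: closedI; first exact: compact_closed.
apply: closedI; first exact: closed_closure.
by apply: open_closedC; exact: open_interior.
Qed.

(** * The graph of states and its attractor *)

Definition states := (bool * bool * (bool * bool) * bool *
  {ffun 'I_depth.+1 -> {set 'I_n * 'I_m}})%type.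

(** Only states realized by a non-zero direction are kept: this makes every piece non-empty and
    excludes c = 0, which exposes all of A. *)
Definition vertices := {w : states | `[< exists2 c, c != 0 & state c = w >]}.

(** One witness c suffices: by [state_pullback], F_d sends each point exposed by any direction in
    state v to a point exposed by some direction in state u. *)
Definition transition (u v : vertices) d := exists c, [/\ c != 0,
  state c = val u, state (shrink c) = val v & d \in face (shrink c)].

Definition transitions :=
  {e : vertices * vertices * ('I_n * 'I_m) | `[< transition e.1.1 e.1.2 e.2 >]}.

Lemma out_transition c d (u : vertices) : c != 0 -> state c = val u ->
    d \in face (shrink c) ->
  exists e : transitions, [/\ (val e).1.1 = u, (val e).2 = d &
    val (val e).1.2 = state (shrink c)].
Proof.
move=> c0 su dface.
have sc0 : shrink c != 0 by rewrite shrink_eq0.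
have vP : `[< exists2 c', c' != 0 & state c' = state (shrink c) >].
  by apply/asboolP; exists (shrink c).
pose v : vertices := exist _ (state (shrink c)) vP.
have eP : `[< transition u v d >] by apply/asboolP; exists c.
by exists (exist _ (u, v, d) eP).
Qed.

Lemma transitions_lipschitz (e : transitions) : exists q : {nonneg R},
  q%:num < 1 /\ q%:num.-lipschitz (@bm_map R n m (val e).2).
Proof.
have q0 : 0 <= m%:R^-1 :> R by rewrite invr_ge0 ltW.
exists (NngNum q0); split; last exact: lipschitz_bm_map.
by rewrite /= invf_lt1// ltr1n.
Qed.

Lemma transitions_out (u : vertices) : exists e : transitions, (val e).1.1 = u.
Proof.
have /asboolP[c c0 su] := valP u.
have [x xexp] := exposed_nonempty c.
have [d [y [dface _ _]]] := exposed_inv xexp.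
by have [e [eu _ _]] := out_transition c0 su dface; exists e.
Qed.

Definition exposed_dgifs : dgifs (R * R)%type :=
  @DGIFS R (R * R)%type vertices transitions
    (fun e : transitions => (val e).1.1) (fun e : transitions => (val e).1.2)
    (fun e : transitions => @bm_map R n m (val e).2)
    transitions_lipschitz transitions_out.

Definition pieces (u : vertices) : set (R * R)%type :=
  \bigcup_(c in [set c | c != 0 /\ state c = val u]) exposed c.

Lemma pieces_sub u : pieces u `<=` A.
Proof. by move=> x [c _ []]. Qed.

Lemma compact_closure_pieces u : compact (closure (pieces u)).
Proof.
case: hA => _ cA _; apply: (subclosed_compact _ cA).
  exact: closed_closure.
have cA' : closed A by exact: compact_closed.
rewrite [X in _ `<=` X](closure_id A).1//; apply: closureS; exact: pieces_sub.
Qed.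

Lemma bm_map_pieces (e : transitions) y : pieces (val e).1.2 y ->
  pieces (val e).1.1 (bm_map (val e).2 y).
Proof.
have /asboolP[c [c0 su sv dface]] := valP e.
move=> [c' [c'0 sc'] yexp].
have [|c'' [c''0 sc'' yexp'' fE]] := @state_pullback c c' y c0 _ yexp.
  by rewrite sc'.
exists c''; first by rewrite /= sc''.
apply: exposed_bm_map => //; rewrite fE.
(* The faces agree because they are the entries at k = 0 of equal states. *)
suff -> : face c' = face (shrink c) by [].
by apply: (@state_face c' (shrink c) _ 0%N); rewrite ?sc' ?sv.
Qed.

Lemma pieces_attractor :
  @is_dgifs_attractor R (R * R)%type exposed_dgifs (closure \o pieces).
Proof.
move=> u; split.
- have /asboolP[c c0 su] := valP u.
  have [x xexp] := exposed_nonempty c.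
  by exists x; apply: subset_closure; exists c.
- exact: compact_closure_pieces.
apply/seteqP; split=> /=.
  (* The right-hand side is a finite union of compact images, hence closed, so it suffices to cover
     the piece before taking its closure. *)
  set U := (X in _ `<=` X).
  have cU : closed U.
    apply: closed_bigcup => [|v _]; first exact: finite_finset.
    apply: closed_bigcup => [|e _]; first exact: finite_finset.
    apply: compact_closed => //; apply: continuous_compact.
      exact/continuous_subspaceT/continuous_bm_map.
    exact: compact_closure_pieces.
  rewrite [U](closure_id U).1//; apply: closureS => x [c [c0 su] xexp].
  have [d [y [dface yexp ->]]] := exposed_inv xexp.
  have [e [eu ed ev]] := out_transition c0 su dface.
  exists (val e).1.2 => //; exists e; first by split.
  exists y; last by rewrite /= ed.
  by apply: subset_closure; exists (shrink c) => //=; rewrite shrink_eq0.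
(* By continuity, F_d maps the closure of the target piece into the closure of the source piece. *)
move=> _ [v _ [e [<- <-] [y ycl <-]]] V Vn.
have /ycl[z [zp Vz]] := continuous_bm_map Vn.
exists (bm_map (val e).2 z); split=> //.
exact: bm_map_pieces.
Qed.

Lemma ext_pieces : ext A = \bigcup_u closure (pieces u).
Proof.
apply/seteqP; split=> [x|x [u _]]; last first.
  rewrite [ext A](closure_id _).1; last exact: closed_ext.
  by apply: closureS => {}x [c [c0 _] xexp]; rewrite extE; exists c.
rewrite extE => -[c c0 xexp].
have uP : `[< exists2 c', c' != 0 & state c' = state c >].
  by apply/asboolP; exists c.
by exists (exist _ (state c) uP) => //; apply: subset_closure; exists c.
Qed.
End Exposed.

Set Strict Implicit.
Unset Implicit Arguments.

Theorem theorem4p3 (R : realType) (n m : nat) (hm : (2 <= m)%N)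
    (hnm : (m < n)%N) (D : {set 'I_n * 'I_m}) (hD : D != finset.set0)
    (A : set (R * R)%type)
    (hA : is_attractor [set` D] (@bm_map R n m) A) :
  described_by (boundary_digits R D) (@bm_map R n m) (ext A).
Proof.
exists (exposed_dgifs hm hnm hA), (closure \o @pieces R n m D A); split.
- move=> e; exists (val e).2 => //.
  (* The digit of an edge maximizes the non-zero direction T c over D, hence lies on the boundary of
     conv(D). *)
  have /asboolP[c [c0 _ _ dface]] := valP e.
  by apply: boundary_face dface; rewrite (shrink_eq0 hm hnm).
- exact: pieces_attractor.
- exact: ext_pieces.
Qed.
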